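(* For every $k,d$ there exists an $(\epsilon,\delta)$-differentially private algorithm that is an $(\alpha=0,\beta)$-PAC (non-agnostic) $k$-learner for $\operatorname{PAR}_d$ under the uniform distribution, with sample complexity $O\big(d\log(\tfrac{1}{\beta})+ \tfrac{1}{\epsilon}\log(\tfrac{1}{\beta\delta})\big)$.
   Context: $\operatorname{PAR}_d=\{c_x : x\in\{0,1\}^d\}$ with $c_x(y)=\langle x,y\rangle \bmod 2$, functions on $X=\{0,1\}^d$. Let $U_d$ be the uniform distribution on $\{0,1\}^d$. An algorithm $\mathcal A$ taking a $k$-labeled database (element of $(X\times\{0,1\}^k)^n$) and outputting $k$ hypotheses $(h_1,\dots,h_k)$ is an $(\alpha,\beta)$-PAC $k$-learner for $\operatorname{PAR}_d$ under the uniform distribution with sample complexity $n$ if for every $c_1,\dots,c_k\in\operatorname{PAR}_d$, given $S=((x_i,c_1(x_i),\dots,c_k(x_i)))_{i=1}^n$ with $x_i$ i.i.d. from $U_d$, $\Pr[\max_j \Pr_{x\sim U_d}[h_j(x)\neq c_j(x)]>\alpha]\leq\beta$ (over the sample and the coins of $\mathcal A$). Two $k$-labeled databases of the same size are neighboring if they differ in exactly one entry; $\mathcal A$ is $(\epsilon,\delta)$-differentially private if for all neighboring $S,S'$ and all output sets $T$, $\Pr[\mathcal A(S)\in T]\leq e^\epsilon\Pr[\mathcal A(S')\in T]+\delta$.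
   Formalization: The constant in O(·) may depend on an arbitrary upper bound β₀ < 1 for β (it does not depend on k, d, ε, δ); with one constant for all β < 1 the claim fails, e.g. ε = 1, δ = 1/2, β = 1 − 1/d with d and k large. *)

(* Defs.v *)
From HB Require Import structures.
From mathcomp Require Import all_boot all_order all_algebra.
From mathcomp Require Import reals.
From mathcomp.analysis Require Import sequences exp.
Set Implicit Arguments.
Unset Strict Implicit.
Unset Printing Implicit Defensive.
Import Order.TTheory GRing.Theory Num.Theory.
Local Open Scope ring_scope.

Record dist (R : realType) (T : finType) := Dist {
  mass :> T -> R;
  mass_ge0 : forall t, 0 <= mass t;
  mass_sum1 : \sum_t mass t = 1 }.

Definition Pr (R : realType) (T : finType) (P : dist R T) (E : {set T}) : R :=
  \sum_(t in E) P t.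

Section Constructions.
Variable R : realType.

Section Uniform.
Variables (T : finType) (t0 : T).

Lemma uniform_ge0 (t : T) : 0 <= (#|T|%:R : R)^-1.
Proof. by rewrite invr_ge0 ler0n. Qed.

Lemma uniform_sum1 : \sum_(t : T) (#|T|%:R : R)^-1 = 1.
Proof.
rewrite sumr_const -[LHS]mulr_natl divff // pnatr_eq0 -lt0n.
by apply/card_gt0P; exists t0.
Qed.

Definition uniform : dist R T := Dist uniform_ge0 uniform_sum1.
End Uniform.

Section Iid.
Variables (T : finType) (n : nat) (P : dist R T).

Lemma iid_ge0 (x : {ffun 'I_n -> T}) : 0 <= \prod_(i < n) P (x i).
Proof. by apply: prodr_ge0 => i _; exact: mass_ge0. Qed.

Lemma iid_sum1 : \sum_(x : {ffun 'I_n -> T}) \prod_(i < n) P (x i) = 1.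
Proof.
by rewrite -(bigA_distr_bigA (fun _ => P)) big1 // => i _; exact: mass_sum1.
Qed.

Definition iid : dist R {ffun 'I_n -> T} := Dist iid_ge0 iid_sum1.
End Iid.

Section Bind.
Variables (T U : finType) (P : dist R T) (K : T -> dist R U).

Lemma bind_ge0 (u : U) : 0 <= \sum_t P t * K t u.
Proof. by apply: sumr_ge0 => t _; rewrite mulr_ge0 ?mass_ge0. Qed.

Lemma bind_sum1 : \sum_u \sum_t P t * K t u = 1.
Proof.
rewrite exchange_big -[RHS](mass_sum1 P) /=; apply: eq_bigr => t _.
by rewrite -mulr_sumr mass_sum1 mulr1.
Qed.

(* Draw t from P, then u from K t with fresh coins, and return u. *)
Definition bind : dist R U := Dist bind_ge0 bind_sum1.
End Bind.

End Constructions.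

Definition cube (d : nat) : finType := {ffun 'I_d -> bool}.

Definition concept (d : nat) : finType := {ffun cube d -> bool}.

Definition parity (d : nat) (x : cube d) : concept d :=
  [ffun y : cube d => odd (\sum_(i < d) x i * y i)%N].

Definition PAR (d : nat) : {set concept d} := [set parity x | x : cube d].

Definition unif_cube (R : realType) (d : nat) : dist R (cube d) :=
  uniform R ([ffun=> false] : cube d).

Definition database (k d n : nat) : finType :=
  {ffun 'I_n -> cube d * {ffun 'I_k -> bool}}.

(* The coins of the algorithm are represented by the distribution of its
   output. Hypotheses are arbitrary boolean functions on the cube, which need
   not be parities. *)
Definition algorithm (R : realType) (k d n : nat) : Type :=
  database k d n -> dist R {ffun 'I_k -> concept d}.

Definition neighboring (k d n : nat) (S S' : database k d n) : Prop :=
  #|[set i | S i != S' i]| = 1%N.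

Definition differentially_private (R : realType) (k d n : nat) (eps delta : R)
    (A : algorithm R k d n) : Prop :=
  forall S S' : database k d n, neighboring S S' ->
  forall T : {set {ffun 'I_k -> concept d}},
    Pr (A S) T <= expR eps * Pr (A S') T + delta.

Definition label_sample (k d n : nat) (c : {ffun 'I_k -> concept d})
    (x : {ffun 'I_n -> cube d}) : database k d n :=
  [ffun i => (x i, [ffun j => c j (x i)])].

Definition error (R : realType) (d : nat) (c h : concept d) : R :=
  Pr (unif_cube R d) [set x | h x != c x].

(* Errors are nonnegative, so the default value 0 of the maximum only matters
   when k = 0. *)
Definition max_error (R : realType) (k d : nat)
    (c h : {ffun 'I_k -> concept d}) : R :=
  \big[Num.max/0]_(j < k) error R (c j) (h j).

Definition PAC_learner_PAR_uniform (R : realType) (k d n : nat)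
    (alpha beta : R) (A : algorithm R k d n) : Prop :=
  forall c : {ffun 'I_k -> concept d}, (forall j, c j \in PAR d) ->
    Pr (bind (iid n (unif_cube R d)) (fun x => A (label_sample c x)))
       [set h | alpha < max_error R c h] <= beta.

(* Main.v *)
(* Score a k-tuple of parities by the number of database entries inconsistent
   with it, and let its margin be the gap between its score and the smallest
   score of a competitor. Scores have sensitivity 1, so margins have
   sensitivity 2, and at most one tuple has a positive margin. The learner
   releases that tuple with probability o/(1+o), where the odds o are delta at
   margin 2 and grow like exp(eps margin / 2); otherwise it outputs a fixed
   default. This is private for every eps > 0, and it succeeds with probability
   1 - beta/2 as soon as the margin is t = O(1 + log(1/(beta delta)) / eps).

   On a sample labeled by a tuple of parities the margin is at least the
   minimum, over nonzero z, of the number of sample points x with <z,x> = 1,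
   whatever k is. A Chernoff bound and a union bound over z show that this
   minimum is below t with probability at most exp(d + t - n/4), so
   n = 4(d + t + log(2/beta)) points suffice. *)
Require Import Defs.
From mathcomp Require Import all_boot all_order all_algebra.
From mathcomp Require Import reals.
From mathcomp.analysis Require Import sequences exp.
From mathcomp Require Import ring lra zify.
Import Order.TTheory GRing.Theory Num.Theory.
Local Open Scope ring_scope.

(** * Finite probability: union bounds and conditioning *)

Section Probability.
Context {R : realType} {T : finType}.
Implicit Types (P : dist R T) (E F : {set T}).

Lemma Pr_ge0 P E : 0 <= Pr P E.
Proof. by apply: sumr_ge0 => t _; exact: mass_ge0. Qed.

Lemma Pr_setC P E : Pr P (~: E) = 1 - Pr P E.
Proof.
rewrite -(mass_sum1 P) (bigID (mem E)) /= addrC addrK.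
by apply: eq_bigl => t; rewrite inE.
Qed.

Lemma Pr_le1 P E : Pr P E <= 1.
Proof. by have := Pr_ge0 P (~: E); rewrite Pr_setC subr_ge0. Qed.

Lemma Pr_sub P E F : E \subset F -> Pr P E <= Pr P F.
Proof.
move=> /subsetP sEF; rewrite /Pr [leRHS](bigID (mem E)) /=.
rewrite [X in _ <= X + _](eq_bigl (mem E)); last first.
  by move=> t /=; apply/andP/idP => [[]//|tE]; split=> //; exact: sEF.
by rewrite lerDl sumr_ge0 // => t _; exact: mass_ge0.
Qed.

Lemma Pr_bigcup (I : finType) (Q : pred I) P (E : I -> {set T}) :
  Pr P (\bigcup_(i | Q i) E i) <= \sum_(i | Q i) Pr P (E i).
Proof.
rewrite /Pr; under [leRHS]eq_bigr => i _ do rewrite big_mkcond /=.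
rewrite exchange_big /= big_mkcond /=; apply: ler_sum => t _.
case: ifP => [/bigcupP[i Qi tE]|_].
  rewrite (bigD1 i) //= tE lerDl sumr_ge0 // => j _.
  by case: ifP => // _; exact: mass_ge0.
by apply: sumr_ge0 => i _; case: ifP => // _; exact: mass_ge0.
Qed.

Lemma Pr_bind (U : finType) P (K : T -> dist R U) (E : {set U}) :
  Pr (bind P K) E = \sum_t P t * Pr (K t) E.
Proof.
rewrite /Pr /= exchange_big /=; apply: eq_bigr => t _.
by rewrite mulr_sumr.
Qed.

End Probability.

(** Splits on whether the sample falls in the bad set [G]: there the failure probability is bounded
    by 1, elsewhere by [p]. *)
Lemma Pr_bind_le {R : realType} (T U : finType) (P : dist R T) (K : T -> dist R U) (E : {set U})
    (G : {set T}) (p : R) :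
  (forall t, t \notin G -> Pr (K t) E <= p) -> 0 <= p ->
  Pr (bind P K) E <= p + Pr P G.
Proof.
move=> Kp p0; rewrite Pr_bind -[p]mulr1 -(mass_sum1 P) mulr_sumr /Pr.
rewrite [X in _ + X]big_mkcond /= -big_split /=; apply: ler_sum => t _.
have Pt := mass_ge0 P t; case: ifPn => [tG|/Kp Kt].
  have := ler_wpM2l Pt (Pr_le1 (K t) E); rewrite mulr1 => /le_trans; apply.
  by rewrite lerDr mulr_ge0.
by rewrite addr0 mulrC ler_wpM2r.
Qed.

(** * Releasing one candidate or a default value *)

Section Release.
Context {R : realType} {X Y : finType}.
Variables (f : X -> R) (out : X -> Y) (bot : Y).
Hypotheses (f_ge0 : forall a, 0 <= f a) (f_le1 : \sum_a f a <= 1).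

(** Candidate [a] is released with probability [f a], and all the remaining mass goes to [bot].
    Candidates with the same output are merged, so [out] may fail to be injective. *)
Definition release_mass (y : Y) : R :=
  \sum_(a | out a == y) f a + (1 - \sum_a f a) * (y == bot)%:R.

Lemma release_ge0 y : 0 <= release_mass y.
Proof.
by rewrite addr_ge0 ?sumr_ge0 // mulr_ge0 ?ler0n // subr_ge0.
Qed.

Lemma release_sum (T : {set Y}) :
  \sum_(y in T) release_mass y =
  \sum_(a | out a \in T) f a + (1 - \sum_a f a) * (bot \in T)%:R.
Proof.
rewrite big_split /=; congr (_ + _).
  rewrite (partition_big out (mem T)) //=; apply: eq_bigr => y yT.
  by apply: eq_bigl => a; case: eqP => [->|]; rewrite ?yT ?andbF.
rewrite -mulr_sumr; congr (_ * _).
rewrite big_mkcond /= (bigD1 bot) //= eqxx big1 ?addr0; first by case: ifP.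
by move=> y /negPf->; case: ifP.
Qed.

Lemma release_sum1 : \sum_y release_mass y = 1.
Proof.
rewrite (eq_bigl (mem [set: Y])); last by move=> y; rewrite /= inE.
rewrite release_sum inE mulr1 (eq_bigl xpredT); last by move=> a; rewrite inE.
by rewrite addrC subrK.
Qed.

Definition release : dist R Y :=
  @Dist R Y release_mass release_ge0 release_sum1.

Lemma release_ge a : f a <= release (out a).
Proof.
rewrite /= /release_mass (bigD1 a) //= -addrA lerDl addr_ge0 ?sumr_ge0 //.
by rewrite mulr_ge0 ?ler0n // subr_ge0.
Qed.

Lemma Pr_releaseT (T : {set Y}) : bot \in T ->
  Pr release T = 1 - \sum_(a | out a \notin T) f a.
Proof.
move=> bT; rewrite /Pr release_sum bT mulr1.
by rewrite [in X in _ + X](bigID (fun a => out a \in T)) /=; ring.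
Qed.

Lemma Pr_releaseF (T : {set Y}) : bot \notin T ->
  Pr release T = \sum_(a | out a \in T) f a.
Proof. by move=> /negPf bT; rewrite /Pr release_sum bT mulr0 addr0. Qed.

End Release.

Section AtMostOne.
Context {R : realType} {X : finType}.
Variables (f : X -> R).
Hypotheses (f1 : forall a b, f a != 0 -> f b != 0 -> a = b).

Lemma sum_at_most_one (Q : pred X) :
  \sum_(a | Q a) f a = 0 \/ exists2 b, Q b & \sum_(a | Q a) f a = f b.
Proof.
have [/existsP[b /andP[Qb fb]]|none] := boolP [exists b, Q b && (f b != 0)].
  right; exists b => //; rewrite (bigD1 b) //= big1 ?addr0 // => a /andP[_ ab].
  by apply: contraNeq ab => fa; apply/eqP; exact: f1.
left; rewrite big1 // => a Qa; apply: contraNeq none => fa.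
by apply/existsP; exists a; rewrite Qa.
Qed.

End AtMostOne.

(** As [f] and [g] are each supported on at most one candidate, an event reduces to a single term:
    [f b] if it avoids [bot], [1 - g b] if it contains [bot]. Hence [delta] is paid once rather than
    once per candidate. *)
Lemma release_private {R : realType} {X Y : finType} (out : X -> Y) (bot : Y)
    (f g : X -> R) (e delta : R)
    (f0 : forall a, 0 <= f a) (f1 : \sum_a f a <= 1)
    (g0 : forall a, 0 <= g a) (g1 : \sum_a g a <= 1) :
  (forall a b, f a != 0 -> f b != 0 -> a = b) ->
  (forall a b, g a != 0 -> g b != 0 -> a = b) ->
  1 <= e -> 0 <= delta ->
  (forall a, f a <= e * g a + delta) ->
  (forall a, 1 - f a <= e * (1 - g a) + delta) ->
  forall T, Pr (release f out bot f0 f1) T <=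
            e * Pr (release g out bot g0 g1) T + delta.
Proof.
move=> fu gu e1 d0 fg fgC T; have e0 : 0 <= e by apply: le_trans e1.
case: (boolP (bot \in T)) => bT; last first.
  rewrite !Pr_releaseF //.
  have [->|[b Tb ->]] := sum_at_most_one _ fu (fun a => out a \in T).
    by rewrite addr_ge0 // mulr_ge0 // sumr_ge0.
  apply: le_trans (fg b) _; rewrite lerD2r ler_wpM2l //.
  by rewrite (bigD1 b) //= lerDl sumr_ge0.
rewrite !Pr_releaseT //.
have [->|[b Tb ->]] := sum_at_most_one _ gu (fun a => out a \notin T).
  have : 0 <= \sum_(a | out a \notin T) f a by exact: sumr_ge0.
  by lra.
apply: le_trans (fgC b); rewrite lerD2l lerN2.
by rewrite (bigD1 b) //= lerDl sumr_ge0.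
Qed.

(** * Margins of scores, and the release probability as a function of the margin *)

Section Margin.
Context {X : finType}.
Implicit Types (s : X -> nat) (a b : X) (n m : nat).

(* The cap [n] is only reached when there is no competitor [b != a]. *)
Definition margin n s a : nat :=
  \big[Order.min/n]_(b | b != a) (s b - s a)%N.

Lemma leq_marginP n s a m :
  reflect ((m <= n)%N /\ forall b, b != a -> (m <= s b - s a)%N)
          (m <= margin n s a)%N.
Proof. exact: (bigmin_geP n m (fun b => b != a) (fun b => (s b - s a)%N)). Qed.

Lemma margin_le n s a b : b != a -> (margin n s a <= s b - s a)%N.
Proof. by have /leq_marginP[_] := leqnn (margin n s a); apply. Qed.

(** Two distinct candidates with positive margins would each have a score strictly below the
    other's. *)
Lemma margin_unique n s a b :
  margin n s a != 0%N -> margin n s b != 0%N -> a = b.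
Proof.
have [//|ab] := eqVneq a b.
have ba : b != a by rewrite eq_sym.
by have := margin_le n s a b ba; have := margin_le n s b a ab; lia.
Qed.

(** The scores of [a] and of its competitor each move by at most 1, and the cap [n] is common to
    both margins. *)
Lemma margin_sensitivity n s s' a :
  (forall b, s b <= (s' b).+1)%N -> (forall b, s' b <= (s b).+1)%N ->
  (margin n s a <= margin n s' a + 2)%N.
Proof.
move=> ss' s's; have [mn _] := leq_marginP n s a _ (leqnn _).
rewrite addnC -leq_subLR; apply/leq_marginP; split=> [|b ba]; first by lia.
have := margin_le n s a b ba; have := ss' b; have := s's a; lia.
Qed.

End Margin.

(* The odds are multiplied by [expR (eps / 2)] each time the margin, which has
   sensitivity 2, grows by 1; they are [delta] at margin 2. *)
Section ReleaseProbability.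
Context {R : realType}.
Variables (eps delta : R).
Hypotheses (eps_gt0 : 0 < eps) (delta_itv : 0 < delta < 1).

Definition odds (u : nat) : R := delta * expR (eps / 2 * (u%:R - 2)).

Definition release_prob (u : nat) : R :=
  if u == 0%N then 0 else odds u / (1 + odds u).

Lemma odds_gt0 u : 0 < odds u.
Proof. by case/andP: delta_itv => d0 _; rewrite mulr_gt0 ?expR_gt0. Qed.

Lemma release_probC u : u != 0%N -> 1 - release_prob u = (1 + odds u)^-1.
Proof.
move=> /negPf u0; rewrite /release_prob u0.
by have := odds_gt0 u; move=> ?; field; lra.
Qed.

Lemma release_prob_ge0 u : 0 <= release_prob u.
Proof.
rewrite /release_prob; case: ifP => // _; have := odds_gt0 u => o0.
by rewrite divr_ge0 //; lra.
Qed.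

Lemma release_prob_le1 u : release_prob u <= 1.
Proof.
rewrite /release_prob; case: ifP => // _; have := odds_gt0 u => o0.
by rewrite ler_pdivrMr; lra.
Qed.

Lemma odds_step u v : (u <= v + 2)%N -> odds u <= expR eps * odds v.
Proof.
move=> uv; case/andP: delta_itv => d0 _; rewrite /odds mulrCA ler_pM2l //.
rewrite -expRD ler_expR; have : (u%:R : R) <= v%:R + 2 by rewrite -natrD ler_nat.
have -> : eps + eps / 2 * (v%:R - 2) = eps / 2 * (v%:R + 2 - 2) by field.
by rewrite ler_pM2l ?divr_gt0 // lerD2r.
Qed.

(** [delta] pays for the jump from release probability 0 at margin 0 to any margin reachable in one
    change of the database. *)
Lemma release_prob_small u : (u <= 2)%N -> release_prob u <= delta.
Proof.
case/andP: delta_itv => d0 _; rewrite /release_prob.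
case: ifP => // _ u2; first exact: ltW.
have o0 := odds_gt0 u; rewrite ler_pdivrMr; last lra.
suff : odds u <= delta by nra.
rewrite -[leRHS]mulr1 /odds ler_pM2l // -[leRHS]expR0 ler_expR.
by rewrite pmulr_rle0 ?divr_gt0 // subr_le0 ler_nat.
Qed.

Lemma release_prob_step u v : (u <= v + 2)%N ->
  release_prob u <= expR eps * release_prob v + delta.
Proof.
move=> uv; case/andP: delta_itv => d0 _.
have e1 : 1 < expR eps by rewrite expR_gt1.
have [v0|v0] := eqVneq v 0%N.
  rewrite v0 {2}/release_prob eqxx mulr0 add0r.
  by apply: release_prob_small; rewrite v0 in uv.
have [u0|u0] := eqVneq u 0%N.
  rewrite u0 {1}/release_prob eqxx addr_ge0 ?mulr_ge0 ?release_prob_ge0 //; lra.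
rewrite /release_prob (negPf u0) (negPf v0).
have ou := odds_gt0 u; have ov := odds_gt0 v; have uvo := odds_step u v uv.
rewrite -[leLHS]addr0 lerD ?(ltW d0) // mulrA.
rewrite ler_pdivrMr; last lra.
rewrite mulrAC ler_pdivlMr; last lra.
have : 0 <= odds u * odds v * (expR eps - 1).
  by apply: mulr_ge0; [apply: mulr_ge0; exact: ltW|lra].
by lra.
Qed.

Lemma release_probC_step u v : (v <= u + 2)%N ->
  1 - release_prob u <= expR eps * (1 - release_prob v) + delta.
Proof.
move=> vu; case/andP: delta_itv => d0 d1.
have e1 : 1 < expR eps by rewrite expR_gt1.
have [v0|v0] := eqVneq v 0%N.
  rewrite v0 {2}/release_prob eqxx subr0 mulr1.
  by have := release_prob_ge0 u; lra.
(* If [u] is 0 then [v] is at most 2, so it remains to see that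
   [1 <= expR eps * (1 - delta) + delta]. *)
have [u0|u0] := eqVneq u 0%N.
  rewrite u0 {1}/release_prob eqxx subr0.
  have : release_prob v <= delta by apply: release_prob_small; rewrite u0 in vu.
  by nra.
rewrite !release_probC //.
(* Both sides are now inverses, and [1 + odds v <= 1 + expR eps * odds u <= expR eps * (1 + odds
   u)]. *)
have ou := odds_gt0 u; have ov := odds_gt0 v; have vuo := odds_step v u vu.
rewrite -[leLHS]addr0 lerD ?(ltW d0) //.
rewrite ler_pdivlMr; last lra.
rewrite mulrC ler_pdivrMr; last lra.
by nra.
Qed.

Lemma release_prob_large (t u : nat) (p : R) : 0 < p -> (2 <= t)%N ->
  p^-1 <= odds t -> (t <= u)%N -> 1 - release_prob u <= p.
Proof.
move=> p0 t2 pt tu; rewrite release_probC; last by lia.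
have tuo : odds t <= odds u.
  case/andP: delta_itv => d0 _; rewrite /odds ler_pM2l // ler_expR.
  by rewrite ler_pM2l ?divr_gt0 // lerD2r ler_nat.
have pi0 : 0 < p^-1 by rewrite invr_gt0.
by rewrite -[leRHS]invrK lef_pV2 ?posrE //; lra.
Qed.

End ReleaseProbability.

(** * The private selection mechanism for a score of sensitivity 1 *)

Section Mechanism.
Context {R : realType} {D X Y : finType}.
Variables (n : nat) (score : D -> X -> nat) (out : X -> Y) (bot : Y).
Variables (eps delta : R).
Hypotheses (eps_gt0 : 0 < eps) (delta_itv : 0 < delta < 1).

Let f (S : D) (a : X) : R := release_prob eps delta (margin n (score S) a).

Let f_unique S a b : f S a != 0 -> f S b != 0 -> a = b.
Proof.
move=> fa fb; apply: (margin_unique n (score S)).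
  by apply: contraNneq fa => u0; rewrite /f /release_prob u0.
by apply: contraNneq fb => u0; rewrite /f /release_prob u0.
Qed.

Let f_ge0 S a : 0 <= f S a.
Proof. exact: release_prob_ge0. Qed.

Let f_le1 S : \sum_a f S a <= 1.
Proof.
have [->|[b _ ->]] := sum_at_most_one (f S) (@f_unique S) xpredT.
  exact: ler01.
exact: release_prob_le1.
Qed.

Definition mechanism (S : D) : dist R Y :=
  release (f S) out bot (f_ge0 S) (f_le1 S).

Lemma mechanism_private (S S' : D) :
  (forall a, score S a <= (score S' a).+1)%N ->
  (forall a, score S' a <= (score S a).+1)%N ->
  forall T, Pr (mechanism S) T <= expR eps * Pr (mechanism S') T + delta.
Proof.
move=> SS' S'S; apply: release_private.
- exact: f_unique.
- exact: f_unique.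
- by rewrite ltW // expR_gt1.
- by case/andP: delta_itv => /ltW.
- by move=> a; apply: release_prob_step => //; exact: margin_sensitivity.
- by move=> a; apply: release_probC_step => //; exact: margin_sensitivity.
Qed.

Lemma mechanism_accurate (S : D) (a : X) (t : nat) (p : R) :
  0 < p -> (2 <= t)%N -> p^-1 <= odds eps delta t ->
  (t <= margin n (score S) a)%N ->
  Pr (mechanism S) (~: [set out a]) <= p.
Proof.
move=> p0 t2 pt tu; rewrite Pr_setC [X in 1 - X]big_set1.
apply: le_trans (release_prob_large _ _ eps_gt0 delta_itv _ _ _ p0 t2 pt tu).
by rewrite lerD2l lerN2; exact: (release_ge (f S)).
Qed.

End Mechanism.

(** * Parities as inner products over the two-element field, and their values on random samples *)

Section Parities.
Context {d : nat}.
Implicit Types (x y z : cube d).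

Definition dot z y : bool := \big[addb/false]_i (z i && y i).

Definition cube_xor x y : cube d := [ffun i => x i (+) y i].

Lemma parityE z y : parity z y = dot z y.
Proof.
rewrite ffunE /dot (big_morph odd oddD (erefl : odd 0 = false)).
by apply: eq_bigr => i _; case: (z i); case: (y i).
Qed.

Lemma dotC z y : dot z y = dot y z.
Proof. by apply: eq_bigr => i _; rewrite andbC. Qed.

Lemma dot_xorl x z y : dot (cube_xor x z) y = dot x y (+) dot z y.
Proof.
by rewrite /dot -big_split; apply: eq_bigr => i _; rewrite ffunE andb_addl.
Qed.

Lemma dot_xorr x z y : dot z (cube_xor x y) = dot z x (+) dot z y.
Proof. by rewrite dotC dot_xorl !(dotC _ z). Qed.

Lemma cube_xorK y : involutive (cube_xor ^~ y).
Proof. by move=> x; apply/ffunP => i; rewrite !ffunE addbK. Qed.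

Lemma cube_xor_eq0 x y : (cube_xor x y == [ffun=> false]) = (x == y).
Proof.
apply/eqP/eqP => [/ffunP xy|->]; apply/ffunP => i; last by rewrite !ffunE addbb.
by have := xy i; rewrite !ffunE; case: (x i); case: (y i).
Qed.

Lemma dot_onto z : z != [ffun=> false] -> exists y, dot z y.
Proof.
move=> z0; have [i zi] : exists i, z i.
  apply/existsP; apply: contraNT z0; rewrite negb_exists => /forallP z0.
  by apply/eqP/ffunP => i; rewrite ffunE; apply/negbTE.
exists [ffun j => j == i]; rewrite /dot (bigD1 i) //= big1 ?ffunE ?eqxx ?zi //.
by move=> j /negPf ji; rewrite ffunE ji andbF.
Qed.

(* Translating by a point where [dot z] is true exchanges its two values. *)
Lemma sum_dot (R : realType) z (g : bool -> R) : z != [ffun=> false] ->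
  \sum_y unif_cube R d y * g (dot z y) = (g true + g false) / 2.
Proof.
case/dot_onto => y0 zy0; set s := LHS.
have : s + s = g true + g false.
  transitivity ((\sum_y unif_cube R d y) * (g true + g false)); last first.
    by rewrite mass_sum1 mul1r.
  rewrite {2}/s (reindex_inj (inv_inj (cube_xorK y0))) /= -big_split mulr_suml.
  apply: eq_bigr => y _; rewrite /= dot_xorr zy0 addbT -mulrDr.
  by case: (dot z y) => //=; rewrite addrC.
by lra.
Qed.

Definition hits {n} z (x : {ffun 'I_n -> cube d}) : nat :=
  #|[set i | dot z (x i)]|.

(* Markov's inequality for [2^-(hits z x)], whose mean is [(3/4)^n]. *)
Lemma hits_tail (R : realType) n t z : z != [ffun=> false] ->
  Pr (iid n (unif_cube R d)) [set x | (hits z x < t)%N] <=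
  2 ^+ t * (3 / 4) ^+ n.
Proof.
move=> z0; pose g (b : bool) : R := if b then 2^-1 else 1.
have gmean : \sum_y unif_cube R d y * g (dot z y) = 3 / 4.
  by rewrite sum_dot //= /g; lra.
have -> : 2 ^+ t * (3 / 4) ^+ n =
    \sum_(x : {ffun 'I_n -> cube d})
      2 ^+ t * (\prod_(i < n) (unif_cube R d (x i) * g (dot z (x i)))).
  rewrite -mulr_sumr; congr (_ * _).
  rewrite -(bigA_distr_bigA (fun _ y => unif_cube R d y * g (dot z y))) /=.
  by rewrite prodr_const card_ord gmean.
have hitsE (x : {ffun 'I_n -> cube d}) :
    \prod_(i < n) g (dot z (x i)) = 2^-1 ^+ hits z x.
  transitivity (\prod_(i in [set i | dot z (x i)]) (2^-1 : R)).
    by rewrite [RHS]big_mkcond /=; apply: eq_bigr => i _; rewrite inE.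
  by rewrite prodr_const.
rewrite /Pr big_mkcond /=; apply: ler_sum => x _.
have Px := iid_ge0 (unif_cube R d) x.
(* When there are fewer than [t] hits, [2 ^+ t * 2^-1 ^+ hits z x] is at least 1, so it dominates
   the indicator of the event. *)
rewrite big_split /= hitsE inE; case: ifP => [xt|_].
  rewrite mulrCA ler_peMr // exprVn ler_pdivlMr ?exprn_gt0 ?ltr0n // mul1r.
  by rewrite ler_weXn2l ?ler1n // ltnW.
by rewrite mulr_ge0 ?mulr_ge0 // exprn_ge0 // invr_ge0.
Qed.

Definition few_hits n t : {set {ffun 'I_n -> cube d}} :=
  [set x | [exists z, (z != [ffun=> false]) && (hits z x < t)%N]].

Lemma few_hits_tail (R : realType) n t :
  Pr (iid n (unif_cube R d)) (few_hits n t) <=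
  expR (d%:R + t%:R - n%:R / 4).
Proof.
apply: (@le_trans _ _ (\sum_(z : cube d | z != [ffun=> false])
    Pr (iid n (unif_cube R d)) [set x | (hits z x < t)%N])).
  apply: le_trans (Pr_bigcup _ _ _ _); apply: Pr_sub; apply/subsetP => x.
  rewrite inE => /existsP[z /andP[z0 zx]].
  by apply/bigcupP; exists z => //; rewrite inE.
(* Including [z = 0] makes the number of terms exactly [2 ^ d]. *)
apply: (@le_trans _ _ (\sum_(z : cube d) 2 ^+ t * (3 / 4) ^+ n)).
  rewrite big_mkcond /=; apply: ler_sum => z _; case: ifP => [|_].
    exact: hits_tail.
  by rewrite mulr_ge0 // exprn_ge0 // divr_ge0.
rewrite sumr_const card_ffun card_bool card_ord -[leLHS]mulr_natl natrX.
(* Each of the factors [2 ^ d], [2 ^ t] and [(3/4) ^ n] is turned into an exponential through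
   [1 + x <= expR x]. *)
have e1 : (2 : R) <= expR 1 by have := expR_ge1Dx (1 : R); lra.
have e4 : (3 / 4 : R) <= expR (- 4^-1).
  by have := expR_ge1Dx (- 4^-1 : R); lra.
have -> : d%:R + t%:R - n%:R / 4 =
  1 * d%:R + (1 * t%:R + - 4^-1 * n%:R) :> R by field.
rewrite expRD expRD !expRM_natr.
by rewrite !ler_pM ?mulr_ge0 ?exprn_ge0 ?lerXn2r ?nnegrE ?expR_ge0 ?divr_ge0.
Qed.

End Parities.

(** * The learner for tuples of parities *)

Section Learner.
Context {R : realType} {k d n : nat}.

(** An entry counts once however many of its [k] labels are wrong, which keeps the sensitivity at 1
    for every [k]. *)
Definition inconsistencies (S : database k d n)
    (a : {ffun 'I_k -> cube d}) : nat :=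
  #|[set i | [exists j, parity (a j) (S i).1 != (S i).2 j]]|.

Lemma inconsistencies_neighboring (S S' : database k d n) a :
  neighboring S S' ->
  (inconsistencies S a <= (inconsistencies S' a).+1)%N.
Proof.
rewrite /neighboring => SS'; rewrite -addn1 -SS'.
apply: leq_trans (leq_card_setU _ _); apply/subset_leq_card/subsetP => i.
by rewrite !inE; case: eqP => [->|]; rewrite ?orbF ?orbT.
Qed.

Lemma neighboring_sym (S S' : database k d n) :
  neighboring S S' -> neighboring S' S.
Proof.
rewrite /neighboring => <-; apply: eq_card => i.
by rewrite !inE eq_sym.
Qed.

Lemma inconsistencies_true (a : {ffun 'I_k -> cube d}) x :
  inconsistencies (label_sample [ffun j => parity (a j)] x) a = 0%N.
Proof.
apply: eq_card0 => i; rewrite !inE !ffunE /=; apply/negbTE.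
by rewrite negb_exists; apply/forallP => j; rewrite !ffunE eqxx.
Qed.

(** One coordinate [j] where the tuples differ suffices: every sample point hit by [b j] xor [a j]
    is mislabeled by [b j]. *)
Lemma inconsistencies_false (a b : {ffun 'I_k -> cube d}) x t :
  x \notin few_hits n t -> b != a ->
  (t <= inconsistencies (label_sample [ffun j => parity (a j)] x) b)%N.
Proof.
move=> xt ba; have [j abj] : exists j, b j != a j.
  apply/existsP; apply: contraNT ba; rewrite negb_exists => /forallP ba.
  by apply/eqP/ffunP => j; apply/eqP; rewrite -[_ == _]negbK.
have : (t <= hits (cube_xor (b j) (a j)) x)%N.
  rewrite leqNgt; apply: contra xt => xt; rewrite inE.
  by apply/existsP; exists (cube_xor (b j) (a j)); rewrite cube_xor_eq0 abj.
move=> /leq_trans; apply; apply/subset_leq_card/subsetP => i.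
rewrite !inE dot_xorl -!parityE => hit; apply/existsP; exists j.
have -> : (label_sample [ffun j => parity (a j)] x i).2 j = parity (a j) (x i).
  by rewrite !ffunE.
rewrite [label_sample _ _ _]ffunE /=.
by move: hit; case: (parity (b j) _); case: (parity (a j) _).
Qed.

Definition learner (eps delta : R)
    (delta_itv : 0 < delta < 1) : algorithm R k d n :=
  mechanism n inconsistencies
    (fun a => [ffun j => parity (a j)]) [ffun=> [ffun=> false]]
    eps delta delta_itv.

Lemma learner_private (eps delta : R) (eps_gt0 : 0 < eps)
    (delta_itv : 0 < delta < 1) :
  differentially_private eps delta (learner eps delta delta_itv).
Proof.
move=> S S' SS' T; apply: mechanism_private => // a.
  exact: inconsistencies_neighboring.
by apply: inconsistencies_neighboring; exact: neighboring_sym.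
Qed.

Lemma max_error_refl (c : {ffun 'I_k -> concept d}) : max_error R c c = 0.
Proof.
rewrite /max_error; apply: big1_idem; first exact: maxxx.
move=> j _; rewrite /error /Pr big_pred0 // => x.
by rewrite inE eqxx.
Qed.

Lemma PAR_tuple (c : {ffun 'I_k -> concept d}) : (forall j, c j \in PAR d) ->
  exists a : {ffun 'I_k -> cube d}, c = [ffun j => parity (a j)].
Proof.
move=> cP; have /fin_all_exists[a ca] j : exists x, c j = parity x.
  by have /imsetP[x _ ->] := cP j; exists x.
by exists (finfun a); apply/ffunP => j; rewrite !ffunE.
Qed.

Lemma learner_accurate (eps delta beta : R) (eps_gt0 : 0 < eps)
    (delta_itv : 0 < delta < 1) t :
  0 < beta -> (2 <= t <= n)%N -> 2 / beta <= odds eps delta t ->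
  expR (d%:R + t%:R - n%:R / 4) <= beta / 2 ->
  PAC_learner_PAR_uniform 0 beta (learner eps delta delta_itv).
Proof.
move=> b0 /andP[t2 tn] bt bn c /PAR_tuple[a ->].
(* One half covers a failure to release the true tuple, the other a sample with few hits. *)
have -> : beta = beta / 2 + beta / 2 by field.
apply: le_trans (_ : _ <= beta / 2 + Pr (iid n (unif_cube R d)) (few_hits n t)) _.
  apply: Pr_bind_le => [x xt|]; last by lra.
  apply: le_trans (mechanism_accurate _ _ _ _ _ _ eps_gt0 delta_itv _ a t
    (beta / 2) _ t2 _ _); rewrite ?divr_gt0 ?invf_div //.
    apply: Pr_sub; apply/subsetP => h; rewrite !inE; apply: contraTN => /eqP->.
    by rewrite max_error_refl ltxx.
  apply/leq_marginP; split=> // b ba.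
  by rewrite inconsistencies_true subn0; exact: inconsistencies_false.
by rewrite lerD2l; apply: le_trans bn; exact: few_hits_tail.
Qed.

End Learner.

(** In dimension 0 the only parity is the zero function, which is also the default hypothesis, so
    every output is correct, even with no sample. *)
Lemma learner_accurate_dim0 {R : realType} {k n : nat} (eps delta beta : R)
    (delta_itv : 0 < delta < 1) : 0 <= beta ->
  PAC_learner_PAR_uniform 0 beta (learner eps delta delta_itv : algorithm R k 0 n).
Proof.
move=> b0 c /PAR_tuple[a ->].
have cE (h : {ffun 'I_k -> cube 0}) :
    [ffun j => parity (h j)] = [ffun j => parity (a j)] :> {ffun 'I_k -> concept 0}.
  by apply/ffunP => j; rewrite !ffunE; congr parity; apply/ffunP => -[].
have botE : [ffun=> [ffun=> false]] = [ffun j => parity (a j)]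
    :> {ffun 'I_k -> concept 0}.
  by apply/ffunP => j; apply/ffunP => y; rewrite !ffunE big_ord0.
rewrite Pr_bind big1 // => x _; rewrite Pr_releaseF ?big_pred0 ?mulr0 // => [h|].
  by rewrite inE cE max_error_refl ltxx.
by rewrite inE botE max_error_refl ltxx.
Qed.

(** * Choice of the sample size and of the constant *)

Theorem theorem3p12 (R : realType) (beta0 : R) (hbeta0 : 0 < beta0 < 1) :
  exists2 C : R, 0 < C &
    forall (k d : nat) (eps delta beta : R),
      0 < eps -> 0 < delta < 1 -> 0 < beta <= beta0 ->
      exists n : nat,
        n%:R <= C * (d%:R * ln (1 / beta) + 1 / eps * ln (1 / (beta * delta))) /\
        exists A : algorithm R k d n,
          differentially_private eps delta A /\
          PAC_learner_PAR_uniform 0 beta A.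
Proof.
case/andP: hbeta0 => b00 b01.
have L0 : 0 < ln (1 / beta0) by rewrite ln_gt0 // ltr_pdivlMr // mul1r.
(* Since [beta <= beta0], both logarithms in the bound are at least [K^-1]; multiplying by [K] thus
   absorbs additive constants. *)
pose K := (ln (1 / beta0))^-1; have K0 : 0 < K by rewrite invr_gt0.
exists (24 * K + 8); first by lra.
move=> k d eps delta beta e0 dI /andP[b0 bb0].
have /andP[d0 d1] := dI.
have le_ln u v : 0 < u -> u <= v -> ln u <= ln v :> R.
  by move=> u0 uv; rewrite ler_ln ?posrE //; exact: lt_le_trans uv.
have bd0 : 0 < beta * delta by rewrite mulr_gt0.
have bd_le : beta * delta <= beta by rewrite ler_piMr // ltW.
pose L := ln (1 / beta); pose W := ln (1 / (beta * delta)).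
have L0L : ln (1 / beta0) <= L.
  by apply: le_ln; rewrite !div1r ?invr_gt0 // lef_pV2 ?posrE.
have LW : L <= W by apply: le_ln; rewrite !div1r ?invr_gt0 // lef_pV2 ?posrE.
have KL : 1 <= K * L by rewrite /K mulrC ler_pdivlMr // [leLHS]mul1r.
have KW : 1 <= K * W by apply: le_trans KL _; rewrite ler_pM2l.
pose y := 1 / eps * W.
have ei0 : 0 < 1 / eps by rewrite divr_gt0.
have y0 : 0 <= y by rewrite mulr_ge0 // ltW //; lra.
rewrite -/L -/W -/y.
(* For [d = 0] the term in [d] vanishes and the bound can drop below 1 for large [eps], so the empty
   sample is used. *)
case: d => [|d].
  exists 0%N; split; first by rewrite mul0r add0r mulr_ge0 //; lra.
  exists (learner eps delta dI); split; first exact: learner_private.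
  by apply: learner_accurate_dim0; exact: ltW.
pose D : R := d.+1%:R; have D1 : 1 <= D by rewrite ler1n.
have ln2 : ln 2 <= 1 :> R.
  by rewrite -[leRHS]expRK; apply: le_ln => //; have := expR_ge1Dx (1 : R); lra.
have ln2D u : 0 < u -> ln (2 / u) <= 1 + ln (1 / u) :> R.
  by move=> u0; rewrite div1r lnM ?posrE ?invr_gt0 // lerD2r.
(* Both are rounded up. In [t], one successor does the rounding and two more account for the odds
   being [delta] at margin 2. *)
pose s := (Num.truncn (ln (2 / beta))).+1.
pose t := (Num.truncn (2 / eps * ln (2 / (beta * delta)))).+3.
have ln2V_gt0 u : 0 < u -> u < 1 -> 0 < ln (2 / u) :> R.
  by move=> u0 u1; rewrite ln_gt0 // ltr_pdivlMr //; lra.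
have sI : ln (2 / beta) <= s%:R <= 1 + ln (2 / beta).
  have /andP[sl sr] : (Num.truncn (ln (2 / beta)))%:R <= ln (2 / beta) < s%:R.
    by apply: truncn_itv; apply/ltW/ln2V_gt0 => //; lra.
  by rewrite (ltW sr) /s -natr1; lra.
have tI : 2 / eps * ln (2 / (beta * delta)) <= t%:R - 2 <=
    1 + 2 / eps * ln (2 / (beta * delta)).
  have /truncn_itv : 0 <= 2 / eps * ln (2 / (beta * delta)).
    by rewrite mulr_ge0 ?divr_ge0 ?(ltW e0) //; apply/ltW/ln2V_gt0 => //; lra.
  rewrite /t -addn2 -addn1 !natrD; lra.
(* The exponent in the tail bound becomes exactly [- s]. For the size, [d.+1 + t + s] is at most
   [6 * D + L + 2 / eps + 2 * y], where [D <= K * (D * L)] and [1 / eps <= K * y]; four times this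
   gives the constant [24 * K + 8]. *)
exists (4 * (d.+1 + t + s))%N; split.
  have x1 : L <= D * L by rewrite ler_peMl //; lra.
  have Dx : D <= K * (D * L) by rewrite mulrCA ler_peMr //; lra.
  have ey : 1 / eps <= K * y by rewrite mulrCA ler_peMr // ltW.
  have ty : 2 / eps * ln (2 / (beta * delta)) <= 2 * (1 / eps) + 2 * y.
    have -> : 2 * (1 / eps) + 2 * y = 2 / eps * (1 + W).
      by rewrite /y; field; lra.
    by rewrite ler_pM2l ?divr_gt0 //; exact: ln2D.
  have := ln2D _ b0; rewrite -/L => sL.
  rewrite natrM !natrD -/D; set x := D * L in x1 Dx *.
  have Ky : 0 <= K * y by rewrite mulr_ge0 // ltW.
  by lra.
exists (learner eps delta dI); split; first exact: learner_private.
apply: (learner_accurate _ _ _ e0 dI t) => //.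
- rewrite /=; apply: leq_trans (leq_pmull _ _) => //.
  by rewrite -addnA addnCA leq_addr.
- have -> : 2 / beta = delta * (2 / (beta * delta)) by field; lra.
  rewrite /odds ler_pM2l // -[leLHS]lnK ?posrE ?divr_gt0 // ler_expR.
  have -> : ln (2 / (beta * delta)) =
      eps / 2 * (2 / eps * ln (2 / (beta * delta))) by field; lra.
  by rewrite ler_pM2l ?divr_gt0 //; case/andP: tI.
- have -> : beta / 2 = expR (- ln (2 / beta)).
    by rewrite expRN lnK ?posrE ?divr_gt0 // invf_div.
  by rewrite ler_expR natrM !natrD; lra.
Qed.
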